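(* Let $\Phi\in\mathcal{LP}(\mathbb{I},\mathbb{R}^n)$ admit an EMD on $\mathbb{I}$ with $k\in\{0,\ldots,n\}$. Then any $\Psi\in\mathcal{LP}(\mathbb{I},\mathbb{R}^n)$ with $\tilde d_{\mathbb{I}}(\Phi,\Psi)<\min\{-\overline{\lambda}_k(\Phi),\underline{\lambda}_{n-k}(\Phi)\}$ admits an EMD on $\mathbb{I}$ with (the same) $k$. Moreover, for any such $\Psi$ the extremal subspaces of $\Phi$ can be chosen for the definition of the EMD-projection: if $X\in\mathrm{Gr}(k,\mathbb{R}^n)$ and $Y\in\mathrm{Gr}(n-k,\mathbb{R}^n)$ satisfy $\overline{\lambda}(X,\Phi)=\overline{\lambda}_k(\Phi)$ and $\underline{\lambda}(Y,\Phi)=\underline{\lambda}_{n-k}(\Phi)$, then $\Psi$ admits an EMD with the projection $Q$ given by $\operatorname{im}Q=X$, $\ker Q=Y$.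
   Context: Let $n\ge 1$, let $|\cdot|$ be an arbitrary fixed norm on $\mathbb{R}^n$ with unit sphere $\mathcal{S}$ and induced operator norm $\|\cdot\|$. Let $\mathbb{I}\subset\mathbb{R}$ be compact (not necessarily an interval), $t_-=\min\mathbb{I}$, $t_+=\max\mathbb{I}$, $t_-<t_+$. Put $\mathbb{I}^2_{\neq}=\{(t,s)\in\mathbb{I}\times\mathbb{I}: t\neq s\}$ and let $\overline{\mathbb{I}^2_{\neq}}$ be its closure in $\mathbb{R}^2$. A linear process on $\mathbb{I}$ is a family $\Phi(t,s)\in GL(n,\mathbb{R})$, $t,s\in\mathbb{I}$, such that $(t,s,x)\mapsto\Phi(t,s)x$ is continuous, $\Phi(t,t)=\mathrm{id}$, $\Phi(t,s)\Phi(s,r)=\Phi(t,r)$ for all $t,s,r\in\mathbb{I}$, and $t\mapsto\Phi(t,s)$ is Lipschitz continuous in operator norm for every $s\in\mathbb{I}$. For continuous $f:\mathbb{I}\to(0,\infty)$ let $\Delta(f)(t,s)=\frac{\ln f(t)-\ln f(s)}{t-s}$, $(t,s)\in\mathbb{I}^2_{\neq}$. Standing assumption: $\mathcal{LP}(\mathbb{I},\mathbb{R}^n)$ denotes the set of linear processes $\Phi$ on $\mathbb{I}$ for which $(x,t,s)\mapsto\Delta(|\Phi(\cdot,t_-)x|)(t,s)$ extends continuously from $\mathcal{S}\times\mathbb{I}^2_{\neq}$ to $\mathcal{S}\times\overline{\mathbb{I}^2_{\neq}}$; the extension is denoted by the same symbol. $\mathrm{Gr}(k,\mathbb{R}^n)$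 is the set of $k$-dimensional subspaces of $\mathbb{R}^n$. For a subspace $X\neq\{0\}$, $\underline{\lambda}(X,\Phi)$ and $\overline{\lambda}(X,\Phi)$ are the minimum and the maximum, respectively, of $\Delta(|\Phi(\cdot,t_-)x|)(t,s)$ over $x\in X\cap\mathcal{S}$, $(t,s)\in\overline{\mathbb{I}^2_{\neq}}$; $\underline{\lambda}(\{0\},\Phi)=\infty$, $\overline{\lambda}(\{0\},\Phi)=-\infty$. Extremal growth rates: for $k\in\{1,\ldots,n\}$, $\underline{\lambda}_k(\Phi)=\max_{X\in\mathrm{Gr}(k,\mathbb{R}^n)}\underline{\lambda}(X,\Phi)$ and $\overline{\lambda}_k(\Phi)=\min_{X\in\mathrm{Gr}(k,\mathbb{R}^n)}\overline{\lambda}(X,\Phi)$; $\underline{\lambda}_0(\Phi)=\infty$, $\overline{\lambda}_0(\Phi)=-\infty$. Subspaces attaining these extrema are called extremal subspaces. $\Phi$ admits an exponential monotonicity dichotomy (EMD) on $\mathbb{I}$ with $k\in\{0,\ldots,n\}$ if $\overline{\lambda}_k(\Phi)<0<\underline{\lambda}_{n-k}(\Phi)$. It admits an EMD with the (linear) projection $Q$ on $\mathbb{R}^n$ if $\overline{\lambda}(\operatorname{im}Q,\Phi)<0<\underline{\lambda}(\ker Q,\Phi)$. Semimetric: $\tilde d_{\mathbb{I}}(\Phi,\Psi)=\sup_{X\in\mathrm{Gr}(1,\mathbb{R}^n)}\max\{|\underline{\lambda}(X,\Phi)-\underline{\lambda}(X,\Psi)|,|\overline{\lambda}(X,\Phi)-\overline{\lambda}(X,\Psi)|\}$.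 *)

(* Defs.v *)
From HB Require Import structures.
From mathcomp Require Import all_boot all_order all_algebra.
From mathcomp Require Import all_classical all_reals all_analysis.

Set Implicit Arguments.
Unset Strict Implicit.
Unset Printing Implicit Defensive.

Import Order.TTheory GRing.Theory Num.Theory.
Import numFieldNormedType.Exports.

Local Open Scope classical_set_scope.
Local Open Scope ring_scope.

Section Defs.
Context (R : realType) (n : nat).

(* The norm on R^n is an arbitrary function N, independent of the canonical
   (sup) norm of 'cV[R]_n; the latter is used only for its topology. *)
Record is_norm (N : 'cV[R]_n -> R) : Prop := IsNorm {
  is_norm_eq0 : forall x, N x = 0 -> x = 0;
  is_normZ : forall a x, N (a *: x) = `|a| * N x;
  is_norm_triangle : forall x y, N (x + y) <= N x + N y }.

Definition unit_sphere (N : 'cV[R]_n -> R) : set 'cV[R]_n :=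
  [set x | N x = 1].

Definition opnorm (N : 'cV[R]_n -> R) (A : 'M[R]_n) : R :=
  sup [set N (A *m x) | x in unit_sphere N].

(* I is compact and nonempty, so inf I and sup I are its min and max. *)
Definition tmin (I : set R) : R := inf I.
Definition tmax (I : set R) : R := sup I.

Definition offdiag (I : set R) : set (R * R) :=
  [set p | [/\ I p.1, I p.2 & p.1 != p.2]].

(* Phi is total on R * R, but only its values on I * I are constrained
   and used. *)
Record linear_process (I : set R) (N : 'cV[R]_n -> R)
    (Phi : R -> R -> 'M[R]_n) : Prop := LinearProcess {
  linear_process_unit : forall t s, I t -> I s -> Phi t s \in unitmx;
  linear_process_continuous :
    {within (I `*` I) `*` [set: 'cV[R]_n],
       continuous (fun q : (R * R) * 'cV[R]_n => Phi q.1.1 q.1.2 *m q.2)};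
  linear_process_id : forall t, I t -> Phi t t = 1%:M;
  linear_process_comp : forall t s r, I t -> I s -> I r ->
    Phi t s *m Phi s r = Phi t r;
  linear_process_lipschitz : forall s, I s -> exists L : R,
    forall t t', I t -> I t' ->
      opnorm N (Phi t s - Phi t' s) <= L * `|t - t'| }.

Definition Delta (f : R -> R) (t s : R) : R := (ln (f t) - ln (f s)) / (t - s).

Definition Delta_process (I : set R) (N : 'cV[R]_n -> R)
    (Phi : R -> R -> 'M[R]_n) (q : 'cV[R]_n * (R * R)) : R :=
  Delta (fun t => N (Phi t (tmin I) *m q.1)) q.2.1 q.2.2.

Definition is_Delta_extension (I : set R) (N : 'cV[R]_n -> R)
    (Phi : R -> R -> 'M[R]_n) (g : 'cV[R]_n * (R * R) -> R) : Prop :=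
  {within unit_sphere N `*` closure (offdiag I), continuous g} /\
  {in unit_sphere N `*` offdiag I, g =1 Delta_process I N Phi}.

Definition LP (I : set R) (N : 'cV[R]_n -> R) : set (R -> R -> 'M[R]_n) :=
  [set Phi | linear_process I N Phi /\
             exists g, is_Delta_extension I N Phi g].

(* For Phi in LP, two extensions agree on sphere * closure (offdiag I), as
   sphere * offdiag I is dense there; values elsewhere are never used. *)
Definition Delta_ext (I : set R) (N : 'cV[R]_n -> R)
    (Phi : R -> R -> 'M[R]_n) : 'cV[R]_n * (R * R) -> R :=
  xget (fun=> 0) (is_Delta_extension I N Phi).

Definition growth_values (I : set R) (N : 'cV[R]_n -> R)
    (X : {vspace 'cV[R]_n}) (Phi : R -> R -> 'M[R]_n) : set (\bar R) :=
  [set (Delta_ext I N Phi q)%:E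
     | q in [set x | x \in X /\ unit_sphere N x] `*` closure (offdiag I)].

(* For Phi in LP and X != 0 the infimum and supremum are attained, since
   Delta_ext is continuous on a compact set; for X = 0 the set is empty and
   they are +oo and -oo. *)
Definition lambda_low (I : set R) (N : 'cV[R]_n -> R)
    (X : {vspace 'cV[R]_n}) (Phi : R -> R -> 'M[R]_n) : \bar R :=
  ereal_inf (growth_values I N X Phi).
Definition lambda_up (I : set R) (N : 'cV[R]_n -> R)
    (X : {vspace 'cV[R]_n}) (Phi : R -> R -> 'M[R]_n) : \bar R :=
  ereal_sup (growth_values I N X Phi).

Definition Gr (k : nat) : set {vspace 'cV[R]_n} := [set X | \dim X = k].

(* Attained by compactness of Gr k. For k = 0, Gr 0 only contains the zero
   subspace, which gives the conventional values +oo and -oo. *)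
Definition lambda_low_ (I : set R) (N : 'cV[R]_n -> R) (k : nat)
    (Phi : R -> R -> 'M[R]_n) : \bar R :=
  ereal_sup [set lambda_low I N X Phi | X in Gr k].
Definition lambda_up_ (I : set R) (N : 'cV[R]_n -> R) (k : nat)
    (Phi : R -> R -> 'M[R]_n) : \bar R :=
  ereal_inf [set lambda_up I N X Phi | X in Gr k].

Definition EMD (I : set R) (N : 'cV[R]_n -> R) (Phi : R -> R -> 'M[R]_n)
    (k : nat) : Prop :=
  (lambda_up_ I N k Phi < 0)%E /\ (0 < lambda_low_ I N (n - k) Phi)%E.

Definition is_projection (Q : 'End('cV[R]_n)) : Prop := (Q \o Q)%VF = Q.

Definition EMD_proj (I : set R) (N : 'cV[R]_n -> R) (Phi : R -> R -> 'M[R]_n)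
    (Q : 'End('cV[R]_n)) : Prop :=
  [/\ is_projection Q, (lambda_up I N (limg Q) Phi < 0)%E
    & (0 < lambda_low I N (lker Q) Phi)%E].

Definition dtilde (I : set R) (N : 'cV[R]_n -> R)
    (Phi Psi : R -> R -> 'M[R]_n) : \bar R :=
  ereal_sup [set Order.max
      `|lambda_low I N X Phi - lambda_low I N X Psi|%E
      `|lambda_up I N X Phi - lambda_up I N X Psi|%E | X in Gr 1].

End Defs.

(* Main.v *)
Require Import Defs.
From HB Require Import structures.
From mathcomp Require Import all_boot all_order all_algebra.
From mathcomp Require Import all_classical all_reals all_analysis.

Set Implicit Arguments.
Unset Strict Implicit.
Unset Printing Implicit Defensive.

Import Order.TTheory GRing.Theory Num.Theory.
Import numFieldNormedType.Exports.

Local Open Scope classical_set_scope.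
Local Open Scope ring_scope.

(** The growth values of a process on a subspace X are the union of its growth
    values on the lines contained in X.  Hence a bound d on the change of the
    extremal rates of every line, which is what the semimetric [dtilde]
    measures, bounds by d the change of the extremal rates of X, for X of any
    dimension ([lambda_up_le_add], [lambda_low_le_add]).

    If d is smaller than the gap of the dichotomy of Phi, a subspace whose
    upper rate for Phi is below - d therefore has a negative upper rate for
    Psi, and a subspace whose lower rate for Phi is above d has a positive
    lower rate for Psi.  Such subspaces, of dimensions k and n - k, exist
    because d lies strictly within the gap: near-optimal subspaces of Phi will
    do.  This gives the dichotomy of Psi, and the sign conclusions apply in
    particular to extremal subspaces X and Y of Phi.

    Extremal subspaces X and Y have trivial intersection, since every growth
    value along a common nonzero vector would be both negative and positive
    ([capv_eq0_lambda]).  Their dimensions add up to n, so they are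
    complementary and determine one projection
    ([complement_exists_unique_projection]). *)

Section Projections.
Variables (K : fieldType) (vT : vectType K).

Lemma projection_eq_limg_lker (P Q : 'End(vT)) :
  (P \o P)%VF = P -> (Q \o Q)%VF = Q -> limg P = limg Q -> lker P = lker Q ->
  P = Q.
Proof.
move=> PP QQ imE kerE; apply/lfunP => v.
have PK w : P (P w) = P w by rewrite -comp_lfunE PP.
have QK w : Q (Q w) = Q w by rewrite -comp_lfunE QQ.
(* P fixes Q v, which lies in im P, and kills v - Q v, which lies in ker P *)
have /memv_imgP[w _ Qv] : Q v \in limg P by rewrite imE memv_img ?memvf.
have : v - Q v \in lker P by rewrite kerE memv_ker linearB /= QK subrr.
by rewrite memv_ker linearB /= subr_eq0 => /eqP ->; rewrite Qv PK.
Qed.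

Lemma complement_exists_unique_projection (U V : {vspace vT}) :
  (U :&: V)%VS = 0%VS -> (U + V)%VS = fullv ->
  exists! Q : 'End(vT), [/\ (Q \o Q)%VF = Q, limg Q = U & lker Q = V].
Proof.
move=> UV0 UVT; have VU0 : (V :&: U)%VS = 0%VS by rewrite capvC.
have piP : [/\ (daddv_pi U V \o daddv_pi U V)%VF = daddv_pi U V,
    limg (daddv_pi U V) = U & lker (daddv_pi U V) = V].
  split.
  - by apply/lfunP => v; rewrite comp_lfunE daddv_pi_proj.
  - apply/vspaceP => v; apply/memv_imgP/idP => [[w _ ->]|vU].
      exact: memv_pi.
    by exists v; rewrite ?memvf// daddv_pi_id.
  - apply/vspaceP => v; rewrite memv_ker.
    have := @daddv_pi_add _ _ U V v UV0; rewrite UVT memvf => /(_ isT) vE.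
    apply/eqP/idP => [v0|vV]; first by rewrite -vE v0 add0r memv_pi.
    by move: vE; rewrite (daddv_pi_id VU0 vV) -{3}[v]add0r => /addIr.
exists (daddv_pi U V); split => // Q [QQ imQ kerQ]; have [pp imp kerp] := piP.
by apply: projection_eq_limg_lker; rewrite // ?imQ ?kerQ.
Qed.

End Projections.

(** A finite distance forces both values to be finite, because the difference
    of two equal infinities is infinite in [\bar R]. *)
Lemma abse_sub_le_fin (R : realType) (a b : \bar R) (d : R) :
  (`|a - b| <= d%:E)%E -> (a <= b + d%:E)%E /\ (b <= a + d%:E)%E.
Proof.
case: a b => [a| |] [b| |] //=; rewrite ?leye_eq//.
rewrite -!EFinD !lee_fin ler_distl => /andP[dab abd].
by rewrite abd -lerBlDr dab.
Qed.

Section GrowthRates.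
Context (R : realType) (n : nat) (N : 'cV[R]_n -> R) (I : set R).
Implicit Types (X Y : {vspace 'cV[R]_n}) (Phi Psi : R -> R -> 'M[R]_n).

Lemma is_norm_ge0 (hN : is_norm N) x : 0 <= N x.
Proof.
have N0 : N 0 = 0 by rewrite -(scale0r 0) (is_normZ hN) normr0 mul0r.
have := is_norm_triangle hN x (-1 *: x).
by rewrite (is_normZ hN) normrN1 mul1r scaleN1r subrr N0 -mulr2n pmulrn_lge0.
Qed.

Lemma unit_sphere_normalize (hN : is_norm N) x :
  x != 0 -> unit_sphere N ((N x)^-1 *: x).
Proof.
move=> x0; have Nx0 : N x != 0.
  by apply: contra_neq x0 => /(is_norm_eq0 hN).
rewrite /unit_sphere /= (is_normZ hN) ger0_norm ?invr_ge0 ?is_norm_ge0//.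
by rewrite mulVf.
Qed.

Lemma unit_sphere_neq0 (hN : is_norm N) x : unit_sphere N x -> x != 0.
Proof.
apply: contraPneq => ->; rewrite /unit_sphere /= -(scale0r 0) (is_normZ hN).
by rewrite normr0 mul0r => /esym/eqP; rewrite oner_eq0.
Qed.

Lemma offdiag_nonempty : tmin I < tmax I -> offdiag I !=set0.
Proof.
move=> lt_t; have [[a Ia]|I0] := pselect (I !=set0); last first.
  move: lt_t; rewrite /tmin /tmax.
  by have /set0P/negP/negPn/eqP -> := I0; rewrite inf0 sup0 ltxx.
have [[b [Ib ba]]|nI] := pselect (exists b, I b /\ b != a).
  by exists (b, a).
suff I1 : I = [set a] by move: lt_t; rewrite /tmin /tmax I1 inf1 sup1 ltxx.
apply/seteqP; split => [b Ib|_ ->//]; apply/eqP; apply/negP => ba.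
by apply: nI; exists b; split => //; apply/negP.
Qed.

Lemma lambda_up_mono X Y Phi :
  (X <= Y)%VS -> (lambda_up I N X Phi <= lambda_up I N Y Phi)%E.
Proof.
move=> /subvP XY; apply: ereal_sup_le => _ [q [[qX Nq] qI] <-].
by exists q => //; split => //; split => //; exact: XY.
Qed.

Lemma lambda_low_anti X Y Phi :
  (X <= Y)%VS -> (lambda_low I N Y Phi <= lambda_low I N X Phi)%E.
Proof.
move=> /subvP XY; apply: ereal_inf_le_tmp => _ [q [[qX Nq] qI] <-].
by exists q => //; split => //; split => //; exact: XY.
Qed.

Lemma dtilde_line (hN : is_norm N) Phi Psi (d : R) x :
  (dtilde I N Phi Psi <= d%:E)%E -> unit_sphere N x ->
  (`|lambda_low I N <[x]> Phi - lambda_low I N <[x]> Psi| <= d%:E)%E /\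
  (`|lambda_up I N <[x]> Phi - lambda_up I N <[x]> Psi| <= d%:E)%E.
Proof.
move=> dd Nx; apply/andP; rewrite -ge_max; apply: le_trans dd.
apply: ereal_sup_ubound; exists <[x]>%VS => //.
by rewrite /Gr /= dim_vline unit_sphere_neq0.
Qed.

(** Each growth value on X is already a growth value on the line through the
    unit vector where it is taken, and for lines the bound is the definition
    of [dtilde]. *)
Lemma lambda_up_le_add (hN : is_norm N) Phi Psi (d : R) X :
  (dtilde I N Phi Psi <= d%:E)%E ->
  (lambda_up I N X Psi <= lambda_up I N X Phi + d%:E)%E.
Proof.
move=> dd; apply: ge_ereal_sup => _ [[x p] [[/= xX Nx] pI] <-].
have [_ /abse_sub_le_fin[_ line]] := dtilde_line hN dd Nx.
have xXs : (<[x]> <= X)%VS by rewrite -memvE.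
apply: (@le_trans _ _ (lambda_up I N <[x]> Psi)).
  apply: ereal_sup_ubound; exists (x, p) => //.
  by split => //; split => //=; exact: memv_line.
by apply: (le_trans line); rewrite leeD2r// lambda_up_mono.
Qed.

(** The lower rates are handled with the roles of the processes exchanged, so
    that d is again added on the right. *)
Lemma lambda_low_le_add (hN : is_norm N) Phi Psi (d : R) X :
  (dtilde I N Phi Psi <= d%:E)%E ->
  (lambda_low I N X Phi <= lambda_low I N X Psi + d%:E)%E.
Proof.
move=> dd; rewrite -leeBlDr//.
apply: le_ereal_inf_tmp => _ [[x p] [[/= xX Nx] pI] <-].
have [/abse_sub_le_fin[line _] _] := dtilde_line hN dd Nx.
have xXs : (<[x]> <= X)%VS by rewrite -memvE.
apply: (@le_trans _ _ (lambda_low I N <[x]> Psi)); last first.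
  apply: ereal_inf_lbound; exists (x, p) => //.
  by split => //; split => //=; exact: memv_line.
by rewrite EFinN leeBlDr//; apply: le_trans line; exact: lambda_low_anti.
Qed.

(** A common nonzero vector, normalized, yields a growth value that is at most
    the upper rate of X and at least the lower rate of Y; some pair of times is
    needed to have a value at all. *)
Lemma capv_eq0_lambda (hN : is_norm N) (hI : offdiag I !=set0) Phi X Y :
  (lambda_up I N X Phi < 0)%E -> (0 < lambda_low I N Y Phi)%E ->
  (X :&: Y)%VS = 0%VS.
Proof.
move=> upX lowY; apply/eqP; rewrite -subv0; apply/subvP => x.
rewrite memv_cap memv0 => /andP[xX xY]; apply/negPn/negP => x0.
case: hI => p /(@subset_closure _ (offdiag I)) pI.
have Nu := unit_sphere_normalize hN x0.
set u := _ *: x in Nu.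
have gX : ((Delta_ext I N Phi (u, p))%:E <= lambda_up I N X Phi)%E.
  by apply: ereal_sup_ubound; exists (u, p) => //; do 2!split => //; exact: memvZ.
have gY : (lambda_low I N Y Phi <= (Delta_ext I N Phi (u, p))%:E)%E.
  by apply: ereal_inf_lbound; exists (u, p) => //; do 2!split => //; exact: memvZ.
have := lt_le_trans lowY (le_trans gY gX).
by rewrite ltNge (ltW upX).
Qed.

End GrowthRates.

Theorem theorem3p10 (R : realType) (n : nat) (hn : (1 <= n)%N)
    (N : 'cV[R]_n -> R) (hN : is_norm N)
    (I : set R) (hI : compact I) (hI_lt : tmin I < tmax I)
    (Phi : R -> R -> 'M[R]_n) (hPhi : LP I N Phi)
    (k : nat) (hk : (k <= n)%N) (hEMD : EMD I N Phi k) :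
  forall Psi : R -> R -> 'M[R]_n, LP I N Psi ->
    (dtilde I N Phi Psi
       < Order.min (- lambda_up_ I N k Phi) (lambda_low_ I N (n - k) Phi))%E ->
    EMD I N Psi k /\
    (forall X Y : {vspace 'cV[R]_n}, Gr k X -> Gr (n - k) Y ->
       lambda_up I N X Phi = lambda_up_ I N k Phi ->
       lambda_low I N Y Phi = lambda_low_ I N (n - k) Phi ->
       exists! Q : 'End('cV[R]_n),
         [/\ limg Q = X, lker Q = Y & EMD_proj I N Psi Q]).
Proof.
move=> Psi _ dist_lt.
have [up_neg low_pos] := hEMD.
(* the distance may be -oo, and then the positivity of the gap allows d = 0 *)
have [d dist_d d_lt] : exists2 d : R, (dtilde I N Phi Psi <= d%:E)%E &
    (d%:E < Order.min (- lambda_up_ I N k Phi) (lambda_low_ I N (n - k) Phi))%E.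
  case: (dtilde I N Phi Psi) dist_lt => [r| |] dist_lt.
  - by exists r.
  - by move: dist_lt; rewrite ltNge leey.
  - by exists 0; rewrite ?leNye// lt_min oppe_gt0 up_neg.
move: d_lt; rewrite lt_min => /andP[]; rewrite lteNr => up_lt low_gt.
have upPsi X : (lambda_up I N X Phi < - d%:E)%E -> (lambda_up I N X Psi < 0)%E.
  move=> upX; apply: le_lt_trans (lambda_up_le_add hN _ dist_d) _.
  by rewrite -lteBrDr// sub0e.
have lowPsi Y : (d%:E < lambda_low I N Y Phi)%E -> (0 < lambda_low I N Y Psi)%E.
  move=> lowY; have := lt_le_trans lowY (lambda_low_le_add hN Y dist_d).
  by rewrite -lteBlDr// subee.
split.
  split.
    have [_ [X GX <-] /upPsi upX] := ereal_inf_lt up_lt.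
    by apply: le_lt_trans upX; apply: ereal_inf_lbound; exists X.
  have [_ [Y GY <-] /lowPsi lowY] := ereal_sup_gt low_gt.
  by apply: lt_le_trans lowY _; apply: ereal_sup_ubound; exists Y.
move=> X Y dimX dimY upX lowY.
have XY0 : (X :&: Y)%VS = 0%VS.
  by apply: (capv_eq0_lambda hN (offdiag_nonempty hI_lt) (Phi := Phi));
    rewrite ?upX ?lowY.
have XYT : (X + Y)%VS = fullv.
  have dimT : dim 'cV[R]_n = n by rewrite dim_matrix; exact: muln1.
  apply/eqP; rewrite eqEdim subvf dimvf dimT.
  by rewrite andTb (dimv_disjoint_sum XY0) (dimX : \dim X = k) (dimY : \dim Y = _) subnKC.
have [Q [[QQ imQ kerQ] Quniq]] := complement_exists_unique_projection XY0 XYT.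
exists Q; split; last by move=> P [imP kerP [PP _ _]]; exact: Quniq.
split => //; split => //; rewrite ?imQ ?kerQ.
- by apply: upPsi; rewrite upX.
- by apply: lowPsi; rewrite lowY.
Qed.
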